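(* Let $\mathcal{X}:I\times I\to\mathbb{R}^3$ be a $C^4$ immersion and $\mathcal{M}=\{\mathcal{X}(\mathbf{Y}):\mathbf{Y}\in I\times I\}$. Suppose that $\mathbf{Y}(\cdot,t)$ (with values in $I\times I$) is a 1-periodic solution of the parabolic equation $$\partial_t\mathbf{Y}=a\,\partial_s^2\mathbf{Y}+\mathbf{G}(\mathbf{Y},\partial_s\mathbf{Y})+\alpha\,\partial_s\mathbf{Y},\qquad \mathbf{Y}(\cdot,0)=\mathbf{Y}_0(\cdot),$$ where $ds=|\nabla\mathcal{X}(\mathbf{Y})^\top\partial_u\mathbf{Y}|\,du$, $a=a(\mathcal{X}(\mathbf{Y}),\nabla\mathcal{X}(\mathbf{Y})^\top\partial_s\mathbf{Y})$, and $\mathbf{G}:\mathbb{R}^2\times\mathbb{R}^2\to\mathbb{R}^2$ is a $C^4$ smooth function. Then the closed curve $\Gamma_t=\{\mathbf{X}(s,t): s\in[0,L(\Gamma_t)]\}\subset\mathcal{M}$, $\mathbf{X}(\cdot,t)=\mathcal{X}(\mathbf{Y}(\cdot,t))$, evolves according to the second order parabolic geometric equation $$\partial_t\mathbf{X}=a\,\partial_s^2\mathbf{X}+\mathbf{F}(\mathbf{X},\partial_s\mathbf{X})+\alpha\,\partial_s\mathbf{X},\qquad \mathbf{X}(\cdot,0)=\mathbf{X}_0(\cdot):=\mathcal{X}(\mathbf{Y}_0(\cdot)),$$ where $$\mathbf{F}(\mathbf{X},\partial_s\mathbf{X})=\nabla\mathcal{X}(\mathbf{Y})^\top\mathbf{G}(\mathbf{Y},\partial_s\mathbf{Y})-a\,\partial_s\mathbf{Y}^\top\nabla^2\mathcal{X}(\mathbf{Y})\,\partial_s\mathbf{Y}.$$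 Here $\mathbf{Y}$ is such that $\mathbf{X}=\mathcal{X}(\mathbf{Y})\in\mathcal{M}$ and $$\partial_s\mathbf{Y}=\left(\nabla\mathcal{X}(\mathbf{Y})\nabla\mathcal{X}(\mathbf{Y})^\top\right)^{-1}\nabla\mathcal{X}(\mathbf{Y})\,\partial_s\mathbf{X},$$ where the $2\times3$ matrix $(\nabla\mathcal{X}(\mathbf{Y})\nabla\mathcal{X}(\mathbf{Y})^\top)^{-1}\nabla\mathcal{X}(\mathbf{Y})$ is the left Moore-Penrose pseudoinverse of the $3\times2$ matrix $\nabla\mathcal{X}(\mathbf{Y})^\top$. The curve $\Gamma_t$, $t\ge0$, evolves according to the geometric equation $\partial_t\mathbf{X}=v_N\mathbf{N}+v_B\mathbf{B}+v_T\mathbf{T}$ with the normal, binormal and tangential velocities $$v_N=a\,\kappa+\mathbf{F}^\top\mathbf{N},\qquad v_B=\mathbf{F}^\top\mathbf{B},\qquad v_T=\mathbf{F}^\top\mathbf{T}+\alpha.$$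
   Context: $I=\mathbb{R}/\mathbb{Z}\simeq S^1$. Maps on $I\times I$ are identified with maps on $\mathbb{R}^2$ that are 1-periodic in each variable, so $\mathcal{X}$ and its derivatives can be evaluated at $\mathbf{Y}=(Y_1,Y_2)^\top\in\mathbb{R}^2$, and $\mathbf{Y}(\cdot,t)$ is treated as a 1-periodic $\mathbb{R}^2$-valued function of $u$, smooth enough for the equation to hold classically, with $|\partial_u\mathbf{Y}|>0$. $\nabla\mathcal{X}(\mathbf{Y})$ is the $2\times3$ matrix with entries $(\nabla\mathcal{X})_{ji}=\partial\mathcal{X}_i/\partial Y_j$, $j=1,2$, $i=1,2,3$; immersion means it has rank 2 everywhere. The vector $\partial_s\mathbf{Y}^\top\nabla^2\mathcal{X}(\mathbf{Y})\,\partial_s\mathbf{Y}\in\mathbb{R}^3$ has components $\partial_s\mathbf{Y}^\top\nabla^2\mathcal{X}_k(\mathbf{Y})\,\partial_s\mathbf{Y}$, $k=1,2,3$, with $\nabla^2\mathcal{X}_k=(\partial^2\mathcal{X}_k/\partial Y_i\partial Y_j)_{i,j=1,2}$. The derivative $\partial_s$ means $\partial_s=|\nabla\mathcal{X}(\mathbf{Y})^\top\partial_u\mathbf{Y}|^{-1}\partial_u$ (for both $\mathbf{Y}$ and $\mathbf{X}$), $\partial_t$ is taken at fixed $u$, and $L(\Gamma_t)$ is the length of $\Gamma_t$. The coefficient $a=a(\mathbf{X},\partial_s\mathbf{X})>0$ is a bounded smooth function and $\alpha$ is a scalar function along the curve. The expression $\mathbf{F}(\mathbf{X},\partial_s\mathbf{X})$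 is evaluated along the curve using the given $\mathbf{Y}(\cdot,t)$. $\mathbf{T}=\partial_s\mathbf{X}$ is the unit tangent, $\kappa=|\partial_s^2\mathbf{X}|$ the curvature, and, where $\kappa>0$, $\mathbf{N}=\kappa^{-1}\partial_s^2\mathbf{X}$ and $\mathbf{B}=\mathbf{T}\times\mathbf{N}$; statements involving $\mathbf{N},\mathbf{B}$ refer to points where $\kappa>0$. *)

(* Defs.v *)
From HB Require Import structures.
From mathcomp Require Import all_boot all_order all_algebra.
From mathcomp Require Import all_classical all_reals all_analysis.

Set Implicit Arguments.
Unset Strict Implicit.
Unset Printing Implicit Defensive.

Import Order.TTheory GRing.Theory Num.Theory.
Import numFieldNormedType.Exports.

Local Open Scope classical_set_scope.
Local Open Scope ring_scope.

(* Between finite-dimensional spaces this is the usual C^k: directional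
   derivatives along all vectors, rather than along a basis, make the
   definition usable on product spaces such as R^2 x R^2. *)
Fixpoint Ck (R : realType) (V W : normedModType R) (k : nat) (f : V -> W)
    {struct k} : Prop :=
  continuous f /\
  match k with
  | 0%N => True
  | k'.+1 => forall v : V, (forall x, derivable f x v) /\ Ck k' ('D_v f)
  end.

Definition dot (R : realType) (n : nat) (u v : 'cV[R]_n) : R :=
  (u^T *m v) 0 0.

(* The library norm `|v| on matrices is the max norm; this is the Euclidean
   one. *)
Definition enorm (R : realType) (n : nat) (v : 'cV[R]_n) : R :=
  Num.sqrt (dot v v).

(* Indices live in 'I_3, hence are added modulo 3. *)
Definition cross (R : realType) (u v : 'cV[R]_3) : 'cV[R]_3 :=
  \col_(i < 3) (u (i + 1) 0 * v (i + 2%:R) 0 - u (i + 2%:R) 0 * v (i + 1) 0).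

Definition basis_vec (R : realType) (n : nat) (j : 'I_n) : 'cV[R]_n :=
  delta_mx j 0.

(* Rows are indexed by the variable, columns by the component of X: this is the
   transpose of the usual Jacobian matrix. *)
Definition grad (R : realType) (X : 'cV[R]_2 -> 'cV[R]_3) (y : 'cV[R]_2) :
    'M[R]_(2, 3) :=
  \matrix_(j < 2, i < 3) 'D_(basis_vec R j) (fun z => X z i 0) y.

Definition hessian (R : realType) (f : 'cV[R]_2 -> R) (y : 'cV[R]_2) :
    'M[R]_2 :=
  \matrix_(i < 2, j < 2) 'D_(basis_vec R i) ('D_(basis_vec R j) f) y.

(* q^T (nabla^2 X)(y) q, a vector of R^3. *)
Definition hess_form (R : realType) (X : 'cV[R]_2 -> 'cV[R]_3)
    (y q : 'cV[R]_2) : 'cV[R]_3 :=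
  \col_(k < 3) dot q (hessian (fun z => X z k 0) y *m q).

Definition immersion (R : realType) (X : 'cV[R]_2 -> 'cV[R]_3) : Prop :=
  forall y, \rank (grad X y) = 2%N.

Definition pinv_grad (R : realType) (X : 'cV[R]_2 -> 'cV[R]_3)
    (y : 'cV[R]_2) : 'M[R]_(2, 3) :=
  invmx (grad X y *m (grad X y)^T) *m grad X y.

(* The four Penrose conditions, and P a left inverse of A. *)
Definition left_moore_penrose (R : realType) (m n : nat) (A : 'M[R]_(m, n))
    (P : 'M[R]_(n, m)) : Prop :=
  [/\ A *m P *m A = A, P *m A *m P = P, (A *m P)^T = A *m P,
      (P *m A)^T = P *m A & P *m A = 1%:M].

(* In the next definitions y is the parameter curve at a fixed time. *)

(* ds/du *)
Definition speed (R : realType) (X : 'cV[R]_2 -> 'cV[R]_3)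
    (y : R -> 'cV[R]_2) (u : R) : R :=
  enorm ((grad X (y u))^T *m derive1 y u).

(* The operator d/ds = (ds/du)^-1 d/du, acting on vector functions of u. *)
Definition D_s (R : realType) (X : 'cV[R]_2 -> 'cV[R]_3)
    (y : R -> 'cV[R]_2) (n : nat) (f : R -> 'cV[R]_n.+1) (u : R) :
    'cV[R]_n.+1 :=
  (speed X y u)^-1 *: derive1 f u.

Definition arclength (R : realType) (X : 'cV[R]_2 -> 'cV[R]_3)
    (y : R -> 'cV[R]_2) (u : R) : R :=
  \int[lebesgue_measure]_(v in `[0, u]) speed X y v.

(* Length of one period of a 1-periodic curve. *)
Definition curve_length (R : realType) (x : R -> 'cV[R]_3) : R :=
  \int[lebesgue_measure]_(v in `[0, 1]) enorm (derive1 x v).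

(* f'(t) = l, the difference quotient being restricted to times t + h >= 0:
   the usual derivative for t > 0, the right derivative at t = 0. *)
Definition is_time_derivative (R : realType) (n : nat) (f : R -> 'cV[R]_n.+1)
    (t : R) (l : 'cV[R]_n.+1) : Prop :=
  (fun h => h^-1 *: (f (t + h) - f t)) @
    within [set h : R | 0 <= t + h] (0^') --> l.

(* The force F(x, p) for x = X(y), where p and q stand for the arc-length
   derivatives of x and y. *)
Definition force (R : realType) (X : 'cV[R]_2 -> 'cV[R]_3)
    (G : 'cV[R]_2 * 'cV[R]_2 -> 'cV[R]_2) (a : 'cV[R]_3 * 'cV[R]_3 -> R)
    (y : 'cV[R]_2) (x p : 'cV[R]_3) (q : 'cV[R]_2) : 'cV[R]_3 :=
  (grad X y)^T *m G (y, q) - a (x, p) *: hess_form X y q.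

(* Main.v *)
Require Import Defs.
From HB Require Import structures.
From mathcomp Require Import all_boot all_order all_algebra.
From mathcomp Require Import all_classical all_reals all_analysis.
From mathcomp Require Import ring.
Import Order.TTheory GRing.Theory Num.Theory.
Import numFieldNormedType.Exports.
Local Open Scope classical_set_scope.
Local Open Scope ring_scope.

(** The equation for X(Y(u,t)) is the chain rule applied twice.  Along a curve y
    in the parameter plane, the velocity of X(y) is (grad X)^T y', so that
    D_s X = (grad X)^T D_s Y; differentiating once more, D_s (D_s X) is
    (grad X)^T D_s (D_s Y) plus the quadratic form of the Hessians of X at D_s Y
    (D_s_tangent).  Hence (grad X)^T maps a D_s (D_s Y) + G + alpha D_s Y to
    a D_s (D_s X) + F + alpha D_s X, the force F being defined so as to subtract
    the Hessian term; and (grad X)^T also maps the time derivative of Y to that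
    of X(Y).

    Regularity of X is given through continuous directional derivatives, so the
    chain rule has to be derived from the mean value theorem, one coordinate at a
    time (coordinatewise_mvt, chain_slope).  It is stated for difference
    quotients along an arbitrary filter, to cover both the derivative in u and
    the time derivative, which is one-sided at t = 0.

    Since X is an immersion, the Gram matrix grad (grad)^T is invertible
    (gram_unitmx).  This gives the pseudoinverse and its Penrose conditions, the
    formula for D_s Y in terms of D_s X, and the positivity of the speed.  The
    speed is also continuous, so arc length is strictly increasing and can be
    inverted to parametrize the closed curve (integral_positive_lt,
    reparametrize_closed).

    Finally T is a unit vector, hence orthogonal to its arc-length derivative
    kappa N; where kappa > 0 the triple T, N, T x N is orthonormal, and expanding
    F in it (cross_frame) gives the normal, binormal and tangential
    velocities. *)


Set Implicit Arguments.
Unset Strict Implicit.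
Unset Printing Implicit Defensive.

(** * Entrywise limits of matrices *)

Lemma ler_mx_norm_entry (R : realType) (m n : nat) (M : 'M[R]_(m, n)) i j :
  `|M i j| <= `|M|.
Proof.
by rewrite [leRHS]/Num.Def.normr/= mx_normrE; exact: (le_bigmax _ _ (i, j)).
Qed.

Lemma mx_norm_le (R : realType) (m n : nat) (M : 'M[R]_(m, n)) (e : R) :
  0 <= e -> (forall i j, `|M i j| <= e) -> `|M| <= e.
Proof.
by move=> e0 Me; rewrite [leLHS]/Num.Def.normr/= mx_normrE (bigmax_le _ e0).
Qed.

Lemma cvg_mxP (R : realType) (T : Type) (F : set_system T) (FF : Filter F)
    (m n : nat) (M : T -> 'M[R]_(m, n)) (L : 'M[R]_(m, n)) :
  M t @[t --> F] --> L <-> forall i j, M t i j @[t --> F] --> L i j.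
Proof.
split=> [ML i j|ML]; apply/cvgrPdist_le => /= e e0.
  move/cvgrPdist_le : ML => /(_ e e0); apply: filterS => t.
  apply: le_trans; have := ler_mx_norm_entry (L - M t) i j.
  by rewrite !mxE.
near=> t; apply: mx_norm_le (ltW e0) _ => i j; rewrite !mxE.
suff: forall ij : 'I_m * 'I_n, `|L ij.1 ij.2 - M t ij.1 ij.2| <= e.
  by move=> /(_ (i, j)).
near: t; apply: filter_forall => ij.
exact: ((cvgrPdist_le _ _).1 (ML ij.1 ij.2)).
Unshelve. all: by end_near. Qed.


(** * Chain rule for functions with continuous directional derivatives *)

(** The one-variable mean value theorem for s |-> f (s *: v + x).  The point is
    recorded only through |s| <= |c|, so that no case split on the sign of c is
    left to the users. *)
Lemma mvt_along (R : realType) (V : normedModType R) (f : V -> R) (v x : V)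
    (c : R) :
  (forall z, derivable f z v) ->
  exists2 s : R, `|s| <= `|c| & f (c *: v + x) - f x = 'D_v f (s *: v + x) * c.
Proof.
move=> fv; pose g s := f (s *: v + x).
have dg (s : R) : is_derive s 1 g ('D_v f (s *: v + x)).
  have := fv (s *: v + x).
  have eg : (fun h : R => h^-1 *: ((g \o shift s) (h *: 1) - g s)) =
      (fun h => h^-1 *: ((f \o shift (s *: v + x)) (h *: v) - f (s *: v + x))).
    by apply/funext => h; rewrite /g /= [h *: 1]mulr1 scalerDl -addrA.
  by rewrite /derivable -eg => dgs; split => //; rewrite /derive eg.
have cg A : {within A, continuous g}.
  apply: continuous_subspaceT => s; apply/differentiable_continuous.
  by apply/derivable1_diffP; case: (dg s).
have [c0|c0] := leP 0 c.
  have [s] := MVT_segment c0 (fun s _ => dg s) (cg _).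
  rewrite in_itv/= /g scale0r add0r subr0 => /andP[s0 sc] ->.
  by exists s => //; rewrite !ger0_norm// (le_trans s0).
have [s] := MVT_segment (ltW c0) (fun s _ => dg s) (cg _).
rewrite in_itv/= /g scale0r add0r sub0r mulrN => /andP[cs s0] e.
exists s; first by rewrite !ler0_norm ?lerN2 // ltW.
by apply: oppr_inj; rewrite -e opprB.
Qed.

(** Moving from y to z one coordinate at a time, each move is an increment along
    a single basis vector, to which the mean value theorem applies.  All the
    intermediate points stay in the box spanned by y and z, hence within the
    distance |z - y| of y for the max norm. *)
Lemma coordinatewise_mvt (R : realType) (n : nat) (f : 'cV[R]_n -> R)
    (y z : 'cV[R]_n) :
  (forall j x, derivable f x (basis_vec R j)) ->
  exists xi : 'I_n -> 'cV[R]_n, (forall j, `|xi j - y| <= `|z - y|) /\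
    f z - f y = \sum_(j < n) 'D_(basis_vec R j) f (xi j) * (z - y) j 0.
Proof.
(* The path from y to z: w k has the first k coordinates of z. *)
move=> df; pose w k : 'cV[R]_n := \col_i (if (i < k)%N then z i 0 else y i 0).
have wS (j : 'I_n) : w j.+1 = (z - y) j 0 *: basis_vec R j + w j.
  apply/matrixP => i k; rewrite !mxE (ord1 k) eqxx andbT ltnS.
  have [->|ij] := eqVneq i j.
    by rewrite leqnn ltnn mulr1 subrK.
  by rewrite mulr0 add0r [RHS]/= ltn_neqAle (inj_eq val_inj) ij.
have step (j : 'I_n) : exists x : 'cV[R]_n, `|x - y| <= `|z - y| /\
    f (w j.+1) - f (w j) = 'D_(basis_vec R j) f x * (z - y) j 0.
  rewrite wS; have [s sle ->] := mvt_along (w j) ((z - y) j 0) (df j).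
  exists (s *: basis_vec R j + w j); split=> //.
  apply: mx_norm_le => // i k; rewrite !mxE (ord1 k) eqxx andbT.
  apply: le_trans (ler_mx_norm_entry (z - y) i 0); rewrite !mxE.
  have [->|ij] := eqVneq i j.
    by rewrite ltnn mulr1 addrK (le_trans sle)// !mxE.
  by rewrite mulr0 add0r; case: ifP => // _; rewrite subrr normr0.
have [xi Pxi] := choice step; exists xi; split=> [j|].
  exact: (Pxi j).1.
rewrite -(eq_bigr _ (fun j _ => (Pxi j).2)).
rewrite -(big_mkord xpredT (fun j => f (w j.+1) - f (w j))).
rewrite (telescope_sumr (fun j => f (w j)))//.
congr (f _ - f _); apply/matrixP => i k; rewrite !mxE (ord1 k) ?ltn0 //.
by rewrite ltn_ord.
Qed.

Lemma Ck_continuous (R : realType) (V W : normedModType R) k (f : V -> W) :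
  Ck k f -> continuous f.
Proof. by case: k => [|k] []. Qed.

Lemma Ck_derivable (R : realType) (V W : normedModType R) k (f : V -> W) v x :
  Ck k.+1 f -> derivable f x v.
Proof. by move=> [_ /(_ v)[]]. Qed.

Lemma Ck_derive (R : realType) (V W : normedModType R) k (f : V -> W) v :
  Ck k.+1 f -> Ck k ('D_v f).
Proof. by move=> [_ /(_ v)[]]. Qed.

Lemma Ck_entry (R : realType) (V : normedModType R) (m n k : nat)
    (f : V -> 'M[R]_(m, n)) i j :
  Ck k f -> Ck k (fun z => f z i j).
Proof.
elim: k f => [|k IH] f [cf df]; split.
- by move=> x; apply: (cvg_mxP _ _ _).1; exact: cf.
- by [].
- by move=> x; apply: (cvg_mxP _ _ _).1; exact: cf.
move=> v; have [dfv Cfv] := df v; split=> [x|].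
  exact: (derivable_mxP _ _ _).1.
suff -> : 'D_v (fun z => f z i j) = fun z => 'D_v f z i j by exact: IH.
by apply/funext => z; rewrite derive_mx// mxE.
Qed.

(** Chain rule for difference quotients.  The filter F is arbitrary so that the
    same lemma serves the two-sided derivative in u, where F is 0^', and the
    derivative in t, where h is moreover constrained by 0 <= t + h.  By
    coordinatewise_mvt the quotient for f is the sum over j of the j-th partial
    derivative, at points xi h j which tend to y, times the j-th entry of the
    quotient for z; continuity of the partial derivatives concludes. *)
Lemma chain_slope (R : realType) (n k : nat) (f : 'cV[R]_n -> R)
    (F : set_system R) (FF : Filter F) (z : R -> 'cV[R]_n) (y l : 'cV[R]_n) :
  Ck k.+1 f -> F `=>` (0 : R)^' -> h^-1 *: (z h - y) @[h --> F] --> l ->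
  h^-1 * (f (z h) - f y) @[h --> F] -->
    \sum_(j < n) 'D_(basis_vec R j) f y * l j 0.
Proof.
move=> Cf F0 zl.
have Fn0 : \forall h \near F, h != 0.
  by apply: F0; exact: (nbhs_dnbhs_neq (0 : R)).
have zy : z h @[h --> F] --> y.
  have h0 : h @[h --> F] --> (0 : R).
    move=> A A0; apply: F0; exact: nbhs_dnbhs.
  have : h *: (h^-1 *: (z h - y)) + y @[h --> F] --> 0 *: l + y.
    by apply: cvgD; [exact: cvgZ|exact: cvg_cst].
  rewrite scale0r add0r; apply: cvg_trans; apply: near_eq_cvg; near=> h.
  rewrite scalerA divff ?scale1r ?subrK//; near: h; exact: Fn0.
have [xi Pxi] := choice (fun h => coordinatewise_mvt y (z h)
  (fun j x => Ck_derivable Cf)).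
have xiy j : xi h j @[h --> F] --> y.
  apply/cvgrPdist_le => e e0; move/cvgrPdist_le : zy => /(_ e e0).
  apply: filterS => h; rewrite distrC => zhy.
  by rewrite distrC (le_trans ((Pxi h).1 j)).
have -> : (fun h => h^-1 * (f (z h) - f y)) = (fun h =>
    \sum_(j < n) 'D_(basis_vec R j) f (xi h j) * (h^-1 *: (z h - y)) j 0).
  apply/funext => h; rewrite (Pxi h).2 mulr_sumr; apply: eq_bigr => j _.
  by rewrite mulrCA [in RHS]mxE.
apply: cvg_big => [|j _]; first exact: add_continuous.
apply: cvgM; last exact: (cvg_mxP _ _ _).1.
have cD := Ck_continuous (@Ck_derive _ _ _ _ _ (basis_vec R j) Cf).
exact: (cvg_comp _ _ (xiy j) (cD y)).
Unshelve. all: by end_near. Qed.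

(** * Derivatives of matrices and of surface maps along a curve *)

Lemma is_derive_slopeP (R : realType) (W : normedModType R) (f : R -> W)
    (x : R) (l : W) :
  is_derive x 1 f l <-> h^-1 *: (f (x + h) - f x) @[h --> 0^'] --> l.
Proof.
have -> : (fun h => h^-1 *: (f (x + h) - f x)) =
    (fun h => h^-1 *: ((f \o shift x) (h *: 1) - f x)).
  by apply/funext => h; rewrite /= [_ *: 1]mulr1 [h + x]addrC.
split=> [[df <-] //|fl].
apply: DeriveDef; first by apply/cvg_ex; exists l.
exact: (cvg_lim _ fl).
Qed.

Lemma is_derive_derive1 (R : realType) (W : normedModType R) (f : R -> W)
    (x : R) :
  derivable f x 1 -> is_derive x 1 f (derive1 f x).
Proof. by move=> df; rewrite derive1E; exact: derivableP. Qed.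

Lemma is_derive_mxP (R : realType) (m n : nat) (M : R -> 'M[R]_(m, n)) (x : R)
    (L : 'M[R]_(m, n)) :
  is_derive x 1 M L <-> forall i j, is_derive x 1 (fun t => M t i j) (L i j).
Proof.
split=> [[dM ML] i j|ML].
  apply: DeriveDef; first exact: (derivable_mxP _ _ _).1 dM i j.
  by rewrite -ML derive_mx// mxE.
have dM : derivable M x 1 by apply/derivable_mxP => i j; have [] := ML i j.
apply: DeriveDef => //; rewrite derive_mx//; apply/matrixP => i j.
by rewrite mxE; have [] := ML i j.
Qed.

Lemma is_derive_mulmx (R : realType) (m n p : nat) (A : R -> 'M[R]_(m, n))
    (B : R -> 'M[R]_(n, p)) (x : R) (dA : 'M[R]_(m, n)) (dB : 'M[R]_(n, p)) :
  is_derive x 1 A dA -> is_derive x 1 B dB ->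
  is_derive x 1 (fun t => A t *m B t) (dA *m B x + A x *m dB).
Proof.
move=> /is_derive_mxP hA /is_derive_mxP hB; apply/is_derive_mxP => i j.
have -> : (fun t => (A t *m B t) i j) =
    \sum_(k < n) ((fun t => A t i k) * (fun t => B t k j)).
  by apply/funext => t; rewrite mxE fct_sumE.
apply: is_derive_eq; rewrite !mxE -big_split/=; apply: eq_bigr => k _.
by rewrite addrC; congr (_ + _); rewrite mulrC.
Qed.

Lemma is_derive_trmx (R : realType) (m n : nat) (A : R -> 'M[R]_(m, n)) (x : R)
    (dA : 'M[R]_(m, n)) :
  is_derive x 1 A dA -> is_derive x 1 (fun t => (A t)^T) dA^T.
Proof.
move=> /is_derive_mxP hA; apply/is_derive_mxP => i j.
by under eq_fun do rewrite mxE; rewrite mxE.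
Qed.

Lemma chain_slope_grad (R : realType) (k : nat) (X : 'cV[R]_2 -> 'cV[R]_3)
    (F : set_system R) (FF : Filter F) (z : R -> 'cV[R]_2) (y l : 'cV[R]_2) :
  Ck k.+1 X -> F `=>` (0 : R)^' -> h^-1 *: (z h - y) @[h --> F] --> l ->
  h^-1 *: (X (z h) - X y) @[h --> F] --> (grad X y)^T *m l.
Proof.
move=> CX F0 zl; apply/cvg_mxP => i j; rewrite (ord1 j).
have -> : (fun h => (h^-1 *: (X (z h) - X y)) i 0) =
    (fun h => h^-1 * (X (z h) i 0 - X y i 0)).
  by apply/funext => h; rewrite !mxE.
have -> : ((grad X y)^T *m l) i 0 =
    \sum_(j < 2) 'D_(basis_vec R j) (fun z => X z i 0) y * l j 0.
  by rewrite mxE; under eq_bigr do rewrite !mxE.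
exact: (chain_slope FF (Ck_entry i 0 CX) F0 zl).
Qed.

Section AlongCurve.
Context (R : realType) (k : nat) (X : 'cV[R]_2 -> 'cV[R]_3) (CX : Ck k.+2 X)
  (y : R -> 'cV[R]_2) (u : R) (dy : 'cV[R]_2) (hy : is_derive u 1 y dy).

Lemma is_derive_surface_curve :
  is_derive u 1 (fun v => X (y v)) ((grad X (y u))^T *m dy).
Proof.
apply/is_derive_slopeP; apply: (chain_slope_grad _ CX) => //.
exact: (is_derive_slopeP _ _ _).1 hy.
Qed.

Lemma is_derive_grad_curve :
  is_derive u 1 (fun v => grad X (y v))
    (\matrix_(j, i) (dy^T *m hessian (fun z => X z i 0) (y u)) 0 j).
Proof.
apply/is_derive_mxP => j i; rewrite mxE.
under eq_fun do rewrite mxE.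
have -> : (dy^T *m hessian (fun z => X z i 0) (y u)) 0 j = \sum_(l < 2)
    'D_(basis_vec R l) ('D_(basis_vec R j) (fun z => X z i 0)) (y u) * dy l 0.
  by rewrite mxE; apply: eq_bigr => l _; rewrite !mxE mulrC.
have Cf := @Ck_derive _ _ _ _ _ (basis_vec R j) (Ck_entry i 0 CX).
apply/is_derive_slopeP; apply: (chain_slope _ Cf) => //.
exact: (is_derive_slopeP _ _ _).1 hy.
Qed.

End AlongCurve.

(** * Euclidean geometry: Gram matrices, pseudoinverses, frames *)

Lemma dotE (R : realType) (n : nat) (u v : 'cV[R]_n) :
  dot u v = \sum_(i < n) u i 0 * v i 0.
Proof. by rewrite /dot mxE; under eq_bigr do rewrite mxE. Qed.

Lemma dotC (R : realType) (n : nat) (u v : 'cV[R]_n) : dot u v = dot v u.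
Proof. by rewrite !dotE; apply: eq_bigr => i _; rewrite mulrC. Qed.

Lemma dotZl (R : realType) (n : nat) (c : R) (u v : 'cV[R]_n) :
  dot (c *: u) v = c * dot u v.
Proof. by rewrite /dot linearZ -scalemxAl mxE. Qed.

Lemma dotZr (R : realType) (n : nat) (c : R) (u v : 'cV[R]_n) :
  dot u (c *: v) = c * dot u v.
Proof. by rewrite /dot -scalemxAr mxE. Qed.

Lemma dotvv_ge0 (R : realType) (n : nat) (u : 'cV[R]_n) : 0 <= dot u u.
Proof. by rewrite dotE sumr_ge0// => i _; rewrite -expr2 sqr_ge0. Qed.

Lemma dotvv_eq0 (R : realType) (n : nat) (u : 'cV[R]_n) :
  (dot u u == 0) = (u == 0).
Proof.
apply/eqP/eqP => [|->]; last by rewrite dotE big1// => i _; rewrite mxE mul0r.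
rewrite dotE => /eqP; rewrite psumr_eq0 => [|i _]; last first.
  by rewrite -expr2 sqr_ge0.
move=> /allP u0; apply/matrixP => i j; rewrite (ord1 j) mxE.
have /implyP/(_ isT) := u0 i (mem_index_enum i).
by rewrite mulf_eq0 orbb => /eqP.
Qed.

Lemma enorm_gt0 (R : realType) (n : nat) (u : 'cV[R]_n) :
  (0 < enorm u) = (u != 0).
Proof. by rewrite sqrtr_gt0 lt0r dotvv_ge0 andbT dotvv_eq0. Qed.

Lemma enorm_sqr (R : realType) (n : nat) (u : 'cV[R]_n) :
  enorm u ^+ 2 = dot u u.
Proof. by rewrite sqr_sqrtr// dotvv_ge0. Qed.

(** If w *m (M *m M^T) = 0 then w *m M has zero Euclidean norm, hence vanishes,
    and w = 0 because the rows of M are free. *)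
Lemma gram_unitmx (R : realType) (m n : nat) (M : 'M[R]_(m, n)) :
  row_free M -> M *m M^T \in unitmx.
Proof.
move=> Mfree; rewrite -row_free_unit -kermx_eq0.
set K := kermx _; rewrite -(mulmx_free_eq0 _ Mfree).
apply/eqP/row_matrixP => i; rewrite row0 row_mul.
set v := row i K *m M.
suff: dot v^T v^T == 0.
  by rewrite dotvv_eq0 => /eqP/(congr1 trmx); rewrite trmxK trmx0.
rewrite /dot trmxK /v trmx_mul mulmxA -(mulmxA _ M).
by rewrite -row_mul mulmx_ker row0 mul0mx mxE.
Qed.

Lemma left_moore_penroseP (R : realType) (m n : nat) (M : 'M[R]_(m, n)) :
  M *m M^T \in unitmx ->
  left_moore_penrose M^T (invmx (M *m M^T) *m M).
Proof.
move=> Mu; have PA : invmx (M *m M^T) *m M *m M^T = 1%:M.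
  by rewrite -mulmxA mulVmx.
split=> //; last by rewrite PA trmx1.
- by rewrite -mulmxA PA mulmx1.
- by rewrite PA mul1mx.
- rewrite !trmx_mul trmxK trmx_inv trmx_mul trmxK mulmxA.
  by rewrite -mulmxA.
Qed.

(** The matrix Q with columns T, N and T x N satisfies Q^T Q = 1, hence also
    Q Q^T = 1, and the identity is v = Q (Q^T v). *)
Lemma cross_frame (R : realType) (T N v : 'cV[R]_3) :
  dot T T = 1 -> dot N N = 1 -> dot T N = 0 ->
  v = dot v N *: N + dot v (cross T N) *: cross T N + dot v T *: T.
Proof.
move=> TT NN TN; set B := cross T N.
have i3 (i : 'I_3) : [\/ i = 0, i = 1 | i = 2%:R].
  by case: i => [[|[|[|//]]] Hi]; [constructor 1|constructor 2|constructor 3];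
    apply: val_inj.
have d3 (u w : 'cV[R]_3) :
    dot u w = u 0 0 * w 0 0 + u 1 0 * w 1 0 + u 2%:R 0 * w 2%:R 0.
  rewrite dotE !big_ord_recl big_ord0 addr0 addrA.
  by congr (_ * _ + _ * _ + _ * _); congr (_ _ _); apply: val_inj.
have s3 (g : 'I_3 -> R) : \sum_i g i = g 0 + g 1 + g 2%:R.
  rewrite !big_ord_recl big_ord0 addr0 addrA.
  by congr (_ + _ + _); congr (g _); apply: val_inj.
have B0 : B 0 0 = T 1 0 * N 2%:R 0 - T 2%:R 0 * N 1 0.
  by rewrite mxE; congr (T _ _ * N _ _ - T _ _ * N _ _); apply: val_inj.
have B1 : B 1 0 = T 2%:R 0 * N 0 0 - T 0 0 * N 2%:R 0.
  by rewrite mxE; congr (T _ _ * N _ _ - T _ _ * N _ _); apply: val_inj.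
have B2 : B 2%:R 0 = T 0 0 * N 1 0 - T 1 0 * N 0 0.
  by rewrite mxE; congr (T _ _ * N _ _ - T _ _ * N _ _); apply: val_inj.
clearbody B.
have TB : dot T B = 0 by rewrite d3 B0 B1 B2; ring.
have NB : dot N B = 0 by rewrite d3 B0 B1 B2; ring.
have BB : dot B B = 1.
  (* Lagrange's identity. *)
  have -> : dot B B = dot T T * dot N N - dot T N ^+ 2.
    by rewrite !d3 B0 B1 B2; ring.
  by rewrite TT NN TN expr0n/= subr0 mulr1.
pose col_of (j : 'I_3) := if j == 0 then T else if j == 1 then N else B.
pose Q : 'M[R]_3 := \matrix_(i, j) col_of j i 0.
have QtQ : Q^T *m Q = 1%:M.
  apply/matrixP => i j; rewrite !mxE.
  have -> : \sum_k Q^T i k * Q k j = dot (col_of i) (col_of j).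
    by rewrite dotE; apply: eq_bigr => k _; rewrite !mxE.
  case: (i3 i) => ->; case: (i3 j) => ->;
    rewrite /col_of //= ?TT ?NN ?BB ?TN ?TB ?NB //.
  - by rewrite dotC TN.
  - by rewrite dotC TB.
  - by rewrite dotC NB.
have QQt := mulmx1C QtQ.
rewrite -[LHS]mul1mx -QQt -mulmxA; apply/matrixP => i j; rewrite (ord1 j).
rewrite !mxE s3 !mxE !s3 !mxE !d3 /col_of /=.
ring.
Qed.

Lemma velocity_components (R : realType) (A kappa alpha : R)
    (T N F : 'cV[R]_3) :
  dot T T = 1 -> dot N N = 1 -> dot T N = 0 ->
  (A * kappa + dot F N) *: N + dot F (cross T N) *: cross T N +
    (dot F T + alpha) *: T = A *: (kappa *: N) + F + alpha *: T.
Proof.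
move=> TT NN TN; rewrite [in RHS](cross_frame F TT NN TN).
by rewrite scalerA !scalerDl !addrA.
Qed.

(** * Arc length as a change of parameter *)

Lemma integral_positive_lt (R : realType) (s : R -> R) (a u v : R) :
  continuous s -> (forall x, 0 < s x) -> a <= u -> u < v ->
  \int[lebesgue_measure]_(x in `[a, u]) s x <
    \int[lebesgue_measure]_(x in `[a, v]) s x.
Proof.
move=> cs s0 au uv.
have ints p q : lebesgue_measure.-integrable `[p, q] (EFin \o s).
  apply: continuous_compact_integrable; first exact: segment_compact.
  exact: continuous_subspaceT.
rewrite -subr_gt0 Rintegral_itvB ?bnd_simp //; last exact: ltW.
(* The difference is an integral over [u, v], bounded below by the positive
   minimum s c of s there times the length of the interval. *)
rewrite Rintegral_itv_obnd_cbnd; last first.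
  by apply: integrableS (ints u v) => //; exact: subset_itv_oc_cc.
have [c _ sc] := EVT_min (ltW uv) (continuous_subspaceT cs).
apply: (@lt_le_trans _ _ (\int[lebesgue_measure]_(x in `[u, v]) s c)).
  rewrite Rintegral_cst//= lebesgue_measure_itv/= lte_fin uv/=.
  by rewrite mulr_gt0 ?subr_gt0.
apply: le_Rintegral => //.
apply: continuous_compact_integrable; first exact: segment_compact.
by apply: continuous_subspaceT => x; exact: cvg_cst.
Qed.

(** A strictly increasing S can be inverted on its image, and xs is x composed
    with that inverse.  The inverse is given the value 0 outside the image
    of [0, 1], so that xs takes no other values than those of x on [0, 1]. *)
Lemma reparametrize_closed (R : realType) (T : Type) (x : R -> T) (S : R -> R) :
  S 0 = 0 -> (forall u v, 0 <= u -> u < v -> S u < S v) -> x 1 = x 0 ->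
  exists xs : R -> T, [/\ forall u, 0 <= u <= 1 -> x u = xs (S u),
    xs 0 = xs (S 1) & xs @` `[0, S 1] = x @` `[0, 1]].
Proof.
move=> S0 Slt x10.
have Sle u v : 0 <= u -> u <= v -> S u <= S v.
  by move=> u0; rewrite le_eqVlt => /predU1P[->//|uv]; exact/ltW/Slt.
have Sinj u v : 0 <= u -> 0 <= v -> S u = S v -> u = v.
  move=> u0 v0 Suv; have [uv|vu|//] := ltgtP u v.
    by have := Slt _ _ u0 uv; rewrite Suv ltxx.
  by have := Slt _ _ v0 vu; rewrite Suv ltxx.
pose U s := [set u : R | 0 <= u <= 1 /\ S u = s].
pose inv s := xget 0 (U s).
have invS u : 0 <= u <= 1 -> inv (S u) = u.
  move=> u01; rewrite /inv; case: xgetP => [w _ [/andP[w0 _] Sw]|/(_ u)[]//].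
  by apply: Sinj => //; case/andP: u01.
have inv01 s : 0 <= inv s <= 1.
  by rewrite /inv; case: xgetP => [w _ []//|_]; rewrite lexx ler01.
exists (x \o inv); split=> [u u01||].
- by rewrite /= invS.
- by rewrite -[X in (x \o inv) X]S0 /= !invS ?lexx ?ler01.
apply/seteqP; split=> [_ [s _ <-]|_ [u u01 <-]].
  by exists (inv s) => //=; rewrite in_itv/=.
move: u01; rewrite /= in_itv/= => /andP[u0 u1].
exists (S u); last by rewrite /= invS ?u0.
by rewrite /= in_itv/= -S0 !Sle.
Qed.

(** * Regular curves on an immersed surface *)

Lemma derivable_scalemx (R : realType) (n : nat) (c : R -> R)
    (f : R -> 'cV[R]_n.+1) (x : R) :
  derivable c x 1 -> derivable f x 1 -> derivable (fun t => c t *: f t) x 1.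
Proof.
move=> dc /derivable_mxP df; apply/derivable_mxP => i j.
have -> : (fun t => (c t *: f t) i j) = c * (fun t => f t i j).
  by apply/funext => t; rewrite mxE.
exact: derivableM dc (df i j).
Qed.

Section RegularCurve.
Context (R : realType) (k : nat) (X : 'cV[R]_2 -> 'cV[R]_3) (CX : Ck k.+2 X)
  (Ximm : immersion X) (y : R -> 'cV[R]_2)
  (dy : forall u : R, derivable y u 1)
  (ddy : forall u : R, derivable (derive1 y) u 1)
  (yreg : forall u, 0 < enorm (derive1 y u)).

Let x u := X (y u).
Let v u := (grad X (y u))^T *m derive1 y u.

Lemma derive1_surface_curve u : derive1 x u = v u.
Proof.
rewrite derive1E.
by have [] := is_derive_surface_curve CX (is_derive_derive1 (@dy u)).
Qed.

Lemma gram_grad_unitmx z : grad X z *m (grad X z)^T \in unitmx.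
Proof. by apply: gram_unitmx; rewrite /row_free Ximm. Qed.

Lemma pinv_gradK z : pinv_grad X z *m (grad X z)^T = 1%:M.
Proof. by have [] := left_moore_penroseP (gram_grad_unitmx z). Qed.

(** The pseudoinverse recovers y' from the velocity grad^T y', so the velocity
    of the space curve vanishes only where y' does. *)
Lemma speed_gt0 u : 0 < speed X y u.
Proof.
rewrite /speed enorm_gt0; apply/eqP => v0.
have := yreg u; rewrite enorm_gt0 => /eqP; apply.
by rewrite -[LHS]mul1mx -(pinv_gradK (y u)) -mulmxA v0 mulmx0.
Qed.

Lemma derivable_speed u : derivable (speed X y) u 1.
Proof.
have hv := is_derive_mulmx (is_derive_trmx (is_derive_grad_curve CX
  (is_derive_derive1 (@dy u)))) (is_derive_derive1 (@ddy u)).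
have hvv :=
  (is_derive_mxP _ _ _).1 (is_derive_mulmx (is_derive_trmx hv) hv) 0 0.
have vv0 : 0 < dot (v u) (v u) by rewrite -enorm_sqr exprn_gt0// speed_gt0.
by have [] := is_derive1_comp (is_derive1_sqrt vv0) hvv.
Qed.

Lemma continuous_speed : continuous (speed X y).
Proof.
move=> u; apply/differentiable_continuous/derivable1_diffP.
exact: derivable_speed.
Qed.

Lemma D_s_surface_curve u : D_s X y x u = (grad X (y u))^T *m D_s X y y u.
Proof. by rewrite /D_s derive1_surface_curve scalemxAr. Qed.

Lemma D_s_tangent_unit u : dot (D_s X y x u) (D_s X y x u) = 1.
Proof.
rewrite /D_s dotZl dotZr derive1_surface_curve -enorm_sqr -/(speed X y u).
by rewrite mulrA -invfM -expr2 mulVf// expf_neq0// gt_eqF// speed_gt0.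
Qed.

Lemma derivable_D_s n (f : R -> 'cV[R]_n.+1) u :
  derivable (derive1 f) u 1 -> derivable (D_s X y f) u 1.
Proof.
move=> df; apply: derivable_scalemx df.
apply: derivableV; last exact: derivable_speed.
by rewrite gt_eqF// speed_gt0.
Qed.

Let is_derive_tangent (u : R) : is_derive u 1 (D_s X y x)
  ((\matrix_(j, i) ((derive1 y u)^T *m hessian (fun z => X z i 0) (y u)) 0 j)^T
     *m D_s X y y u + (grad X (y u))^T *m derive1 (D_s X y y) u).
Proof.
rewrite (funext D_s_surface_curve).
apply: is_derive_mulmx; last exact/is_derive_derive1/derivable_D_s.
exact: (is_derive_trmx (is_derive_grad_curve CX (is_derive_derive1 (@dy u)))).
Qed.

Lemma derivable_tangent u : derivable (D_s X y x) u 1.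
Proof. by have [] := is_derive_tangent u. Qed.

(** The second arc-length derivative splits into the image of that of y and a
    second-order term: differentiating T = (grad X (y u))^T *m D_s y by the
    product rule, the derivative of the first factor contributes, once divided
    by the speed, the quadratic form of the Hessians at D_s y.  This term is what
    the force F compensates. *)
Lemma D_s_tangent u : D_s X y (D_s X y x) u =
  (grad X (y u))^T *m D_s X y (D_s X y y) u + hess_form X (y u) (D_s X y y u).
Proof.
rewrite [LHS]/D_s derive1E; have [_ ->] := is_derive_tangent u.
rewrite scalerDr addrC scalemxAr; congr (_ + _).
apply/matrixP => i j; rewrite (ord1 j) !mxE dotE.
rewrite mulr_sumr.
under eq_bigr do rewrite !mxE mulr_suml mulr_sumr.
under [RHS]eq_bigr do rewrite !mxE mulr_sumr.
rewrite exchange_big/=; apply: eq_bigr => l _; apply: eq_bigr => m _.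
by rewrite !mxE; ring.
Qed.

(** T has constant length, so the derivative of dot T T, which is twice the
    product of T with its derivative, vanishes. *)
Lemma curvature_orthogonal u :
  dot (D_s X y x u) (D_s X y (D_s X y x) u) = 0.
Proof.
have hT := is_derive_derive1 (@derivable_tangent u).
have := (is_derive_mxP _ _ _).1 (is_derive_mulmx (is_derive_trmx hT) hT) 0 0.
have -> : (fun t => ((D_s X y x t)^T *m D_s X y x t) 0 0) = cst 1.
  by apply/funext => t; exact: D_s_tangent_unit.
move=> [_]; rewrite derive_cst mxE -/(dot _ _) -[X in _ + X]/(dot _ _).
rewrite dotC -mulr2n => /esym/eqP; rewrite mulrn_eq0/= => /eqP h0.
by rewrite [in X in dot _ X]/D_s dotZr h0 mulr0.
Qed.

End RegularCurve.

(** * The evolution equation and its velocities *)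

Theorem proposition1 (R : realType)
  (X : 'cV[R]_2 -> 'cV[R]_3)
  (hXper : forall (y : 'cV[R]_2) (j : 'I_2), X (y + basis_vec R j) = X y)
  (hXC4 : Ck 4 X)
  (hXimm : immersion X)
  (a : 'cV[R]_3 * 'cV[R]_3 -> R)
  (ha_smooth : forall k : nat, Ck k a)
  (ha_pos : forall z, 0 < a z)
  (ha_bounded : exists M : R, forall z, `|a z| <= M)
  (G : 'cV[R]_2 * 'cV[R]_2 -> 'cV[R]_2)
  (hGC4 : Ck 4 G)
  (alpha : R -> R -> R)
  (Tmax : \bar R)
  (hTmax : (0 < Tmax)%E)
  (Y : R -> R -> 'cV[R]_2)
  (Y0 : R -> 'cV[R]_2)
  (hYper : forall u t : R, 0 <= t -> (t%:E < Tmax)%E -> Y (u + 1) t = Y u t)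
  (hYdiff : forall u t : R, 0 <= t -> (t%:E < Tmax)%E ->
     derivable (Y^~ t) u 1 /\ derivable (derive1 (Y^~ t)) u 1)
  (hYreg : forall u t : R, 0 <= t -> (t%:E < Tmax)%E ->
     0 < enorm (derive1 (Y^~ t) u))
  (hYeq : forall u t : R, 0 <= t -> (t%:E < Tmax)%E ->
     let dsY := D_s X (Y^~ t) (Y^~ t) in
     let dssY := D_s X (Y^~ t) dsY in
     is_time_derivative (Y u) t
       (a (X (Y u t), (grad X (Y u t))^T *m dsY u) *: dssY u
        + G (Y u t, dsY u) + alpha u t *: dsY u))
  (hY0 : forall u : R, Y u 0 = Y0 u) :
  let Xc : R -> R -> 'cV[R]_3 := fun u t => X (Y u t) in
  let manifold : set 'cV[R]_3 := range X in
  (forall u : R, Xc u 0 = X (Y0 u)) /\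
  forall t : R, 0 <= t -> (t%:E < Tmax)%E ->
  let y : R -> 'cV[R]_2 := Y^~ t in
  let x : R -> 'cV[R]_3 := Xc^~ t in
  let dsY := D_s X y y in
  let dsX := D_s X y x in
  let dssX := D_s X y dsX in
  let L := curve_length x in
  (* Gamma_t is a closed curve on the surface, parametrized by arc length *)
  (exists xs : R -> 'cV[R]_3,
     let Gamma : set 'cV[R]_3 := xs @` `[0, L] in
     [/\ forall u : R, 0 <= u <= 1 -> x u = xs (arclength X y u),
         arclength X y 1 = L,
         xs 0 = xs L,
         Gamma = x @` `[0, 1]
       & Gamma `<=` manifold]) /\
  forall u : R,
  let F := force X G a (y u) (x u) (dsX u) (dsY u) in
  let A := a (x u, dsX u) in
  let kappa := enorm (dssX u) in
  let T := dsX u in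
  let N := kappa^-1 *: dssX u in
  let B := cross T N in
  let vN := A * kappa + dot F N in
  let vB := dot F B in
  let vT := dot F T + alpha u t in
  [/\ x (u + 1) = x u,
      derivable x u 1 /\ derivable dsX u 1,
      is_time_derivative (Xc u) t (A *: dssX u + F + alpha u t *: dsX u),
      [/\ grad X (y u) *m (grad X (y u))^T \in unitmx,
          left_moore_penrose (grad X (y u))^T (pinv_grad X (y u))
        & dsY u = pinv_grad X (y u) *m dsX u]
    & 0 < kappa ->
      is_time_derivative (Xc u) t (vN *: N + vB *: B + vT *: T)].
Proof.
move=> Xc manifold; split=> [u|t t0 tT y x dsY dsX dssX L].
  by rewrite /Xc hY0.
have dy u : derivable y u 1 := (hYdiff u t t0 tT).1.
have ddy u : derivable (derive1 y) u 1 := (hYdiff u t t0 tT).2.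
have yreg u : 0 < enorm (derive1 y u) by exact: hYreg.
have xper u : x (u + 1) = x u by rewrite /x /Xc hYper.
split.
  have S1 : arclength X y 1 = L.
    rewrite /arclength /L /curve_length; congr Rintegral.
    by apply/funext => v; rewrite (derive1_surface_curve hXC4 dy).
  have S0 : arclength X y 0 = 0 by rewrite /arclength set_itv1 Rintegral_set1.
  have Slt u v : 0 <= u -> u < v -> arclength X y u < arclength X y v.
    move=> u0 uv; rewrite /arclength.
    apply: (integral_positive_lt (s := speed X y) _ _ u0 uv).
      exact: (continuous_speed hXC4 hXimm dy ddy yreg).
    exact: (speed_gt0 hXimm yreg).
  have x10 : x 1 = x 0 by rewrite -(xper 0) add0r.
  have [xs [xsE xs0 xsG]] := reparametrize_closed S0 Slt x10.
  rewrite S1 in xs0 xsG; exists xs; split=> //.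
  by rewrite xsG => _ [u _ <-]; exists (y u).
move=> u F A kappa T N B vN vB vT.
have dsXE : dsX u = (grad X (y u))^T *m dsY u.
  exact: (D_s_surface_curve hXC4 dy).
have evol : is_time_derivative (Xc u) t (A *: dssX u + F + alpha u t *: dsX u).
  have -> : A *: dssX u + F + alpha u t *: dsX u = (grad X (y u))^T *m
      (a (X (Y u t), (grad X (Y u t))^T *m dsY u) *: D_s X y dsY u
        + G (Y u t, dsY u) + alpha u t *: dsY u).
    rewrite -[Y u t]/(y u) -!dsXE !mulmxDr.
    rewrite -(scalemxAr _ _ (D_s X y dsY u)) -(scalemxAr _ _ (dsY u)) -dsXE.
    (* The Hessian term of dssX cancels the one subtracted in F. *)
    rewrite [dssX u](D_s_tangent hXC4 hXimm dy ddy yreg) /F /force scalerDr.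
    by rewrite [X in X + _ = _]addrACA subrr addr0.
  apply: (chain_slope_grad _ hXC4); last exact: (hYeq u t t0 tT).
  exact: cvg_within.
split=> //.
- split; last exact: (derivable_tangent hXC4 hXimm dy ddy yreg).
  have [dx _] := is_derive_surface_curve hXC4 (is_derive_derive1 (dy u)).
  exact: dx.
- split; first exact: gram_grad_unitmx.
    by apply: left_moore_penroseP; exact: gram_grad_unitmx.
  by rewrite dsXE mulmxA pinv_gradK// mul1mx.
move=> kappa0.
have kN : dssX u = kappa *: N by rewrite scalerA divff ?scale1r// gt_eqF.
have TT : dot T T = 1 by exact: (D_s_tangent_unit hXC4 hXimm dy yreg).
have NN : dot N N = 1.
  rewrite dotZl dotZr mulrA -invfM -expr2 -enorm_sqr.
  by rewrite mulVf// expf_neq0// gt_eqF.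
have TN : dot T N = 0.
  by rewrite dotZr (curvature_orthogonal hXC4 hXimm dy ddy yreg) mulr0.
have := velocity_components A kappa (alpha u t) F TT NN TN.
by rewrite -kN => ->.
Qed.
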